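(* For a twinic group $X$, a maximal linked system $\mathcal L\in\lambda(X)$ belongs to the minimal ideal of the superextension $\lambda(X)$ if and only if its function representation $\Phi_{\mathcal L}$ satisfies two conditions: (1) the family $\Phi_{\mathcal L}(\widehat{\mathsf T})=\{\Phi_{\mathcal L}(A):A\in\widehat{\mathsf T}\}$ is minimal $\widehat{\mathcal K}$-covering; (2) $\Phi_{\mathcal L}(\mathsf P(X))\subset\{\emptyset,X\}\cup\Phi_{\mathcal L}(\widehat{\mathsf T})$.
   Context: Superextension. $\mathsf P(X)$ is the power-set of a group $X$. A family $\mathcal L\subset\mathsf P(X)$ is linked if $A\cap B\ne\emptyset$ for all $A,B\in\mathcal L$, and maximal linked if it is linked and coincides with every linked family containing it. $\lambda(X)$ is the set of maximal linked systems on $X$ with the operation $\mathcal A\circ\mathcal B=\{A\subset X:\{x\in X:x^{-1}A\in\mathcal B\}\in\mathcal A\}$ (and the topology inherited from $\{0,1\}^{\mathsf P(X)}$); it is a compact Hausdorff right-topological semigroup. Its minimal ideal is the smallest two-sided ideal. The function representation of $\mathcal L$ is $\Phi_{\mathcal L}:\mathsf P(X)\to\mathsf P(X)$, $\Phi_{\mathcal L}(A)=\{x\in X:x^{-1}A\in\mathcal L\}$. Twinic groups. An ideal on $X$ is a nonempty family $\mathcal I\subset\mathsf P(X)$ closed under finite unions and subsets, with $X\notin\mathcal I$; left-invariant means $xA\in\mathcal I$ for $A\in\mathcal I$, $x\in X$. $A\subset_{\mathcal I}B$ means $A\setminus B\in\mathcal I$; $A=_{\mathcal I}B$ means both $A\subset_{\mathcal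 I}B$ and $B\subset_{\mathcal I}A$. $X$ is twinic if it admits a left-invariant ideal $\mathcal I$ such that for all $A\subset X$, $x,y\in X$ with $xA\subset_{\mathcal I}X\setminus A\subset_{\mathcal I}yA$ one has $xA=_{\mathcal I}yA$. Twin sets and 2-cogroups. For $A\subset X$ let $\mathrm{Fix}^-(A)=\{x\in X:xA=X\setminus A\}$; $A$ is twin if $\mathrm{Fix}^-(A)\ne\emptyset$; $\mathsf T$ is the family of twin subsets of $X$. A nonempty subset $K\subset X$ is a 2-cogroup if for every $x\in K$ the shift $xK=Kx$ is a subgroup of $X$ disjoint from $K$ (for twin $A$, $\mathrm{Fix}^-(A)$ is a 2-cogroup). $\widehat{\mathcal K}$ is the set of inclusion-maximal 2-cogroups of $X$ and $\widehat{\mathsf T}=\{A\in\mathsf T:\mathrm{Fix}^-(A)\in\widehat{\mathcal K}\}$. A family $\mathsf F\subset\mathsf T$ that is left-invariant (i.e. $xA\in\mathsf F$ for $A\in\mathsf F$, $x\in X$) is $\widehat{\mathcal K}$-covering if for each $K\in\widehat{\mathcal K}$ there is $A\in\mathsf F$ with $\mathrm{Fix}^-(A)=K$; it is minimal $\widehat{\mathcal K}$-covering if it is $\widehat{\mathcal K}$-covering and coincides with each left-invariant $\widehat{\mathcal K}$-covering subfamily of $\mathsf F$. *)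

(* Defs.v *)
From mathcomp Require Import all_boot.
From mathcomp Require Import boolp classical_sets.

Set Implicit Arguments.
Unset Strict Implicit.
Unset Printing Implicit Defensive.

Local Open Scope group_scope.
Local Open Scope classical_set_scope.

(* [groupType] is the structure of arbitrary, possibly infinite and
   non-commutative, groups; subsets are Prop-valued, [P(X)] is [set X]. *)

Definition lmul_set {X : groupType} (x : X) (A : set X) : set X :=
  [set x * a | a in A].

Definition rmul_set {X : groupType} (A : set X) (x : X) : set X :=
  [set a * x | a in A].

Definition left_invariant {X : groupType} (F : set (set X)) : Prop :=
  forall (x : X) (A : set X), F A -> F (lmul_set x A).

Definition inclusion_maximal {T : Type} (C : set (set T)) (A : set T) : Prop :=
  C A /\ forall B : set T, C B -> A `<=` B -> B = A.

Section Superextension.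
Context {X : groupType}.
Implicit Types (A : set X) (L M : set (set X)) (I J : set (set (set X))).

Definition linked L : Prop := L `#` L.

Definition superextension : set (set (set X)) :=
  [set L | inclusion_maximal linked L].

Definition function_repr L A : set X := [set x | L (lmul_set x^-1 A)].

Definition superext_op L M : set (set X) := [set A | L (function_repr M A)].

Definition two_sided_ideal I : Prop :=
  [/\ I !=set0, I `<=` superextension
    & forall L M, superextension L -> I M ->
        I (superext_op L M) /\ I (superext_op M L)].

Definition smallest_two_sided_ideal I : Prop :=
  two_sided_ideal I /\ forall J, two_sided_ideal J -> I `<=` J.

(* There is at most one smallest ideal; membership here asserts both that it
   exists and that [L] lies in it. *)
Definition minimal_ideal : set (set (set X)) :=
  [set L | exists2 I, smallest_two_sided_ideal I & I L].

End Superextension.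

Section Twinic.
Context {X : groupType}.
Implicit Types (A B : set X) (I : set (set X)).

Definition set_ideal I : Prop :=
  [/\ I !=set0,
      forall A B, I A -> I B -> I (A `|` B),
      forall A B, A `<=` B -> I B -> I A
    & ~ I [set: X]].

Definition sub_mod I A B : Prop := I (A `\` B).

Definition eq_mod I A B : Prop := sub_mod I A B /\ sub_mod I B A.

End Twinic.

Definition twinic (X : groupType) : Prop :=
  exists I : set (set X),
    [/\ set_ideal I, left_invariant I
      & forall (A : set X) (x y : X),
          sub_mod I (lmul_set x A) (~` A) -> sub_mod I (~` A) (lmul_set y A) ->
          eq_mod I (lmul_set x A) (lmul_set y A)].

Section TwinSets.
Context {X : groupType}.
Implicit Types (A K : set X) (F G : set (set X)).

Definition Fix_minus A : set X := [set x | lmul_set x A = ~` A].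

Definition twin_sets : set (set X) := [set A | Fix_minus A !=set0].

Definition two_cogroup K : Prop :=
  K !=set0 /\
  forall x, K x -> [/\ lmul_set x K = rmul_set K x,
                       group_closed [in lmul_set x K]
                     & lmul_set x K `&` K = set0].

Definition maximal_two_cogroups : set (set X) :=
  [set K | inclusion_maximal two_cogroup K].

Definition maximal_twin_sets : set (set X) :=
  [set A | twin_sets A /\ maximal_two_cogroups (Fix_minus A)].

Definition covering F : Prop :=
  [/\ F `<=` twin_sets, left_invariant F
    & forall K, maximal_two_cogroups K -> exists2 A, F A & Fix_minus A = K].

Definition minimal_covering F : Prop :=
  covering F /\ forall G, G `<=` F -> covering G -> G = F.

End TwinSets.

(* Main.v *)
(* Sending L to its function representation identifies lambda(X) with the monoid
   of monotone, complement-preserving, equivariant maps P(X) -> P(X), so L lies in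
   the minimal ideal iff f = Phi_L factors as f = p m q for every such map m.

   Such maps preserve Fix^- on T^. A minimal covering family F contained in T^ has
   one orbit per conjugacy class of maximal 2-cogroups, so any endomorphism mapping
   F to itself permutes it; by the twinic property F is moreover an antichain.
   If f satisfies (1) and (2), then f m permutes F = f(T^), the inverse permutation
   extends by the identity on {0, X}, and f = (f m)^-1 f m f.

   Conversely (1) and (2) pass from m to p m q, so it suffices to find one m with
   both properties. It sends each set that is twin modulo the ideal to a member of
   a minimal covering family, and every other A to X or to the empty set according
   to which of A, X \ A lies in a maximal invariant linked family. *)
Require Import Defs.
From mathcomp Require Import all_boot.
From mathcomp Require Import boolp classical_sets.

Set Implicit Arguments.
Unset Strict Implicit.
Unset Printing Implicit Defensive.

Local Open Scope group_scope.
Local Open Scope classical_set_scope.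

(** * Left translates of subsets *)

Section Translates.
Context {X : groupType}.
Implicit Types (x y : X) (A B : set X).

Lemma lmul_setE x A y : lmul_set x A y = A (x^-1 * y).
Proof.
apply/propext; split=> [[a Aa <-]|Ay]; first by rewrite mulKg.
by exists (x^-1 * y) => //; rewrite mulVKg.
Qed.

Lemma lmul_set1 A : lmul_set 1 A = A.
Proof. by apply/funext => y; rewrite lmul_setE invg1 mul1g. Qed.

Lemma lmul_setM x y A : lmul_set x (lmul_set y A) = lmul_set (x * y) A.
Proof. by apply/funext => z; rewrite !lmul_setE invgM mulgA. Qed.

Lemma lmul_setC x A : lmul_set x (~` A) = ~` lmul_set x A.
Proof. by apply/funext => y; rewrite /setC /= !lmul_setE. Qed.

Lemma lmul_setD x A B : lmul_set x (A `\` B) = lmul_set x A `\` lmul_set x B.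
Proof. by apply/funext => y; rewrite /setD /= !lmul_setE. Qed.

Lemma lmul_setI x A B : lmul_set x (A `&` B) = lmul_set x A `&` lmul_set x B.
Proof. by apply/funext => y; rewrite /setI /= !lmul_setE. Qed.

Lemma lmul_setT x : lmul_set x setT = setT.
Proof. by apply/funext => y; rewrite lmul_setE. Qed.

Lemma lmul_set0 x : lmul_set x set0 = set0.
Proof. by apply/funext => y; rewrite lmul_setE. Qed.

Lemma lmul_setS x A B : A `<=` B -> lmul_set x A `<=` lmul_set x B.
Proof. by move=> AB y; rewrite !lmul_setE; apply: AB. Qed.

Lemma lmul_setK x : cancel (lmul_set x) (lmul_set x^-1).
Proof. by move=> A; rewrite lmul_setM mulVg lmul_set1. Qed.

Lemma lmul_setVK x : cancel (lmul_set x^-1) (lmul_set x).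
Proof. by move=> A; rewrite lmul_setM mulgV lmul_set1. Qed.

End Translates.

(** * 2-cogroups: elementwise form, maximal ones, conjugates *)

Section TwoCogroups.
Context {X : groupType}.
Implicit Types (x y z : X) (K : set X).

(** [K] is the nontrivial coset of the subgroup [KK], which has index two in the union of both. In
    this elementwise form the notion passes readily to unions of chains and to conjugates. *)
Lemma two_cogroupP K : two_cogroup K <->
  [/\ K !=set0, forall x, K x -> K x^-1,
      forall x y z, K x -> K y -> K z -> K (x * y * z)
    & forall x y, K x -> K y -> ~ K (x * y)].
Proof.
split=> [[K0 cK]|[K0 KV KM KN]].
  split=> // [x Kx|x y z Kx Ky Kz|x y Kx Ky Kxy].
  - have [_ [xK1 _] _] := cK x Kx.
    by move: xK1; rewrite in_setE lmul_setE mulg1.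
  - have [_ /group_closedM xKM _] := cK y Ky.
    have /xKM : y * x \in lmul_set y K by rewrite in_setE; exists x.
    have /[swap] /[apply] : y * z \in lmul_set y K by rewrite in_setE; exists z.
    by rewrite in_setE lmul_setE !mulgA mulVg mul1g.
  - have [_ _ dK] := cK x Kx.
    have : (lmul_set x K `&` K) (x * y) by split => //; exists y.
    by rewrite dK.
split=> // x Kx; split.
- apply/seteqP; split=> _ [k Kk <-].
    by exists (x * k * x^-1); rewrite ?mulgVK //; apply: KM => //; apply: KV.
  exists (x^-1 * k * x); last by rewrite !mulgA mulgV mul1g.
  by apply: KM => //; apply: KV.
- split=> [|y z]; rewrite !in_setE !lmul_setE.
    by rewrite mulg1; apply: KV.
  move=> Ky Kz; rewrite mulgA.
  have -> : x^-1 * y * z^-1 = x^-1 * y * (x^-1 * z)^-1 * x^-1.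
    by rewrite !invgM invgK !mulgA mulgK.
  by apply: KM; rewrite //; apply: KV.
- apply/seteqP; split=> // y [] [k Kk <-]; exact: KN.
Qed.

Lemma two_cogroup_bigcup (C : set (set X)) :
  C !=set0 -> C `<=` two_cogroup -> total_on C subset ->
  two_cogroup (\bigcup_(K in C) K).
Proof.
move=> [K0 CK0] Ccog Ctot.
have join K1 K2 : C K1 -> C K2 -> exists K3, [/\ C K3, K1 `<=` K3 & K2 `<=` K3].
  by move=> CK1 CK2; case: (Ctot _ _ CK1 CK2); [exists K2 | exists K1]; split.
apply/two_cogroupP; split.
- by have /two_cogroupP[[x K0x] _ _ _] := Ccog _ CK0; exists x, K0.
- move=> x [K CK Kx]; exists K => //.
  by have /two_cogroupP[_ + _ _] := Ccog _ CK; apply.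
- move=> x y z [K1 CK1 Kx] [K2 CK2 Ky] [K3 CK3 Kz].
  have [K4 [CK4 K14 K24]] := join _ _ CK1 CK2.
  have [K [CK K4K K3K]] := join _ _ CK4 CK3.
  exists K => //; have /two_cogroupP[_ _ KM _] := Ccog _ CK.
  by apply: KM; [exact/K4K/K14 | exact/K4K/K24 | exact/K3K].
- move=> x y [K1 CK1 Kx] [K2 CK2 Ky] [K3 CK3 Kz].
  have [K4 [CK4 K14 K24]] := join _ _ CK1 CK2.
  have [K [CK K4K K3K]] := join _ _ CK4 CK3.
  have /two_cogroupP[_ _ _ KN] := Ccog _ CK.
  by apply: (KN x y); [exact/K4K/K14 | exact/K4K/K24 | exact/K3K].
Qed.

Lemma two_cogroup_sub_maximal K : two_cogroup K ->
  exists2 M, maximal_two_cogroups M & K `<=` M.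
Proof.
move=> cK.
have [C CP|M [[M0|[cM KM]] Mmax]] :=
    @Zorn_bigcup X [set M | M = set0 \/ two_cogroup M /\ K `<=` M].
  move=> Ctot.
  have [[M CM M0]|C0] := pselect (exists2 M, C M & M <> set0); last first.
    left; apply/seteqP; split=> // x [M CM Mx]; apply: C0.
    by exists M => // M0; rewrite M0 in Mx.
  right; pose D := [set M | C M /\ M <> set0].
  have bD : \bigcup_(M in C) M = \bigcup_(M in D) M.
    apply/seteqP; split=> x [N CN Nx]; exists N => //; last by case: CN.
    by split=> // N0; rewrite N0 in Nx.
  have DP N : D N -> two_cogroup N /\ K `<=` N.
    by move=> [/CP[]].
  have DM : D M by [].
  rewrite bD; split.
    apply: two_cogroup_bigcup; first by exists M.
      by move=> N /DP[].
    by move=> N1 N2 [? _] [? _]; apply: Ctot.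
  by move=> x Kx; exists M => //; have [_] := DP _ DM; apply.
- exfalso; rewrite M0 in Mmax; apply: (Mmax K); last by right; split.
  have /two_cogroupP[[x Kx] _ _ _] := cK.
  by split => // /(_ x Kx).
- exists M => //; split=> // N cN MN; apply/seteqP; split=> //.
  apply: contrapT => NM; apply: (Mmax N); first by [].
  by right; split=> //; apply: subset_trans MN.
Qed.

(** This is [x * K * x^-1]; translating a set by [x] conjugates its [Fix_minus] in this way. *)
Definition conj_set x K : set X := [set y | K (x^-1 * y * x)].

Lemma conj_set1 K : conj_set 1 K = K.
Proof. by apply/funext => y; rewrite /conj_set /= invg1 mul1g mulg1. Qed.

Lemma conj_setM x y K : conj_set x (conj_set y K) = conj_set (x * y) K.
Proof. by apply/funext => z; rewrite /conj_set /= invgM !mulgA. Qed.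

Lemma conj_two_cogroup x K : two_cogroup K -> two_cogroup (conj_set x K).
Proof.
move/two_cogroupP=> [[k Kk] KV KM KN]; apply/two_cogroupP; split.
- by exists (x * k * x^-1); rewrite /conj_set /= !mulgA mulVg mul1g mulgVK.
- by move=> y /KV; rewrite /conj_set /= !invgM invgK mulgA.
- move=> y z t Ky Kz Kt; have := KM _ _ _ Ky Kz Kt.
  by rewrite /conj_set /= !mulgA !mulgK.
- move=> y z Ky Kz; have := KN _ _ Ky Kz.
  by rewrite /conj_set /= !mulgA !mulgK.
Qed.

Lemma conj_maximal x K :
  maximal_two_cogroups K -> maximal_two_cogroups (conj_set x K).
Proof.
move=> [cK Kmax]; split; first exact: conj_two_cogroup.
move=> B cB KB.
have <- : conj_set x^-1 B = K.
  apply: Kmax; first exact: conj_two_cogroup.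
  move=> y Ky; apply: KB.
  by rewrite /conj_set /= invgK !mulgA mulVg mul1g mulgVK.
by rewrite conj_setM mulgV conj_set1.
Qed.

End TwoCogroups.

(** * Inclusion, equality and twin sets modulo an invariant ideal *)

Section ModIdeal.
Context {X : groupType} (I : set (set X)).
Context (idealI : set_ideal I) (invI : left_invariant I).
Implicit Types (x y : X) (A B C : set X).

Lemma sub_mod_subset A B : A `<=` B -> sub_mod I A B.
Proof.
case: idealI => [[C IC] _ IS _] AB; apply: (IS _ C) => // x [Ax nBx].
by case: nBx; apply: AB.
Qed.

Lemma sub_mod_trans B A C : sub_mod I A B -> sub_mod I B C -> sub_mod I A C.
Proof.
case: idealI => [_ IU IS _] AB BC; apply: IS (IU _ _ AB BC) => x [Ax nCx].
by have [Bx|nBx] := pselect (B x); [right | left].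
Qed.

Lemma sub_modC A B : sub_mod I A B -> sub_mod I (~` B) (~` A).
Proof. by rewrite /sub_mod !setDE setCK setIC. Qed.

Lemma sub_mod_lmul x A B :
  sub_mod I A B -> sub_mod I (lmul_set x A) (lmul_set x B).
Proof. by rewrite /sub_mod -lmul_setD; apply: invI. Qed.

Lemma eq_mod_refl A : eq_mod I A A.
Proof. by split; apply: sub_mod_subset. Qed.

Lemma eq_mod_sym A B : eq_mod I A B -> eq_mod I B A.
Proof. by case. Qed.

Lemma eq_mod_trans B A C : eq_mod I A B -> eq_mod I B C -> eq_mod I A C.
Proof.
by move=> [AB BA] [BC CB]; split; [apply: (sub_mod_trans AB)
  | apply: (sub_mod_trans CB)].
Qed.

Lemma eq_modC A B : eq_mod I A B -> eq_mod I (~` A) (~` B).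
Proof. by move=> [AB BA]; split; apply: sub_modC. Qed.

Lemma eq_mod_lmul x A B :
  eq_mod I A B -> eq_mod I (lmul_set x A) (lmul_set x B).
Proof. by move=> [AB BA]; split; apply: sub_mod_lmul. Qed.

Lemma eq_mod_lmulV x A B :
  eq_mod I (lmul_set x A) (lmul_set x B) -> eq_mod I A B.
Proof. by move/(eq_mod_lmul x^-1); rewrite !lmul_setK. Qed.

Lemma eq_mod_setC A : ~ eq_mod I A (~` A).
Proof.
case: idealI => [_ IU IS nIT] [AnA nAA]; apply: nIT; apply: IS (IU _ _ AnA nAA).
by move=> x _; have [Ax|nAx] := pselect (A x); [left; split | right; split].
Qed.

Definition Fix_minus_mod A : set X :=
  [set x | eq_mod I (lmul_set x A) (~` A)].

Definition twin_mod A : Prop := Fix_minus_mod A !=set0.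

(** Two elements that flip [A] modulo [I] compose to one that fixes it modulo [I], and no element
    does both, because a proper ideal never identifies [A] with its complement. *)
Lemma Fix_minus_mod_two_cogroup A :
  twin_mod A -> two_cogroup (Fix_minus_mod A).
Proof.
move=> twA.
have FD x y : Fix_minus_mod A x -> Fix_minus_mod A y ->
    eq_mod I (lmul_set (x * y) A) A.
  move=> Fx Fy; rewrite -lmul_setM.
  apply: (eq_mod_trans (eq_mod_lmul x Fy)).
  by rewrite lmul_setC -[X in eq_mod _ _ X]setCK; apply: eq_modC.
apply/two_cogroupP; split=> //.
- move=> x Fx; apply: (@eq_mod_lmulV x); rewrite lmul_setVK lmul_setC.
  by rewrite -[X in eq_mod _ X _]setCK; apply/eq_modC/eq_mod_sym.
- move=> x y z Fx Fy Fz; rewrite /Fix_minus_mod /= -mulgA -lmul_setM.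
  apply: eq_mod_trans Fx; exact/eq_mod_lmul/FD.
- move=> x y Fx Fy Fxy; apply: (@eq_mod_setC A).
  by apply: eq_mod_trans Fxy; apply/eq_mod_sym/FD.
Qed.

(** Given one flipping element [k], the flipping elements determine the stabilizer of [A] modulo
    [I]; this is how stabilizers are later compared. *)
Lemma Fix_minus_mod_mul A k x : Fix_minus_mod A k ->
  Fix_minus_mod A (k * x) <-> eq_mod I (lmul_set x A) A.
Proof.
move=> Fk; rewrite /Fix_minus_mod /= -lmul_setM; split=> [Fkx|xA].
  by apply: (@eq_mod_lmulV k); apply: (eq_mod_trans Fkx); apply: eq_mod_sym.
by apply: eq_mod_trans Fk; apply: eq_mod_lmul.
Qed.

Lemma Fix_minus_mod_eq A B :
  eq_mod I A B -> Fix_minus_mod A `<=` Fix_minus_mod B.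
Proof.
move=> AB x Fx; apply: (eq_mod_trans (eq_mod_lmul x (eq_mod_sym AB))).
by apply: (eq_mod_trans Fx); apply: eq_modC.
Qed.

Lemma Fix_minus_mod_lmul x A :
  Fix_minus_mod (lmul_set x A) = conj_set x (Fix_minus_mod A).
Proof.
apply/seteqP; rewrite /conj_set /Fix_minus_mod; split=> y /= Fy.
  apply: (@eq_mod_lmulV x).
  by rewrite lmul_setM -mulgA mulVKg -lmul_setM lmul_setC.
move/(eq_mod_lmul x): Fy.
by rewrite lmul_setM -mulgA mulVKg -lmul_setM lmul_setC.
Qed.

Lemma Fix_minus_sub_mod A : Fix_minus A `<=` Fix_minus_mod A.
Proof.
by move=> x; rewrite /Fix_minus /Fix_minus_mod /= => ->; apply: eq_mod_refl.
Qed.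

Lemma maximal_Fix_minus_mod A :
  maximal_twin_sets A -> Fix_minus_mod A = Fix_minus A.
Proof.
move=> [[k Fk] [_ Kmax]]; apply: Kmax; last exact: Fix_minus_sub_mod.
by apply: Fix_minus_mod_two_cogroup; exists k; apply: Fix_minus_sub_mod.
Qed.

Lemma twin_mod_lmul x A : twin_mod A -> twin_mod (lmul_set x A).
Proof.
move=> [k Fk]; exists (x * k * x^-1).
by rewrite Fix_minus_mod_lmul /conj_set /= !mulgA mulVg mul1g mulgVK.
Qed.

Lemma twin_modC A : twin_mod A -> twin_mod (~` A).
Proof.
move=> [k Fk]; exists k.
by rewrite /Fix_minus_mod /= lmul_setC; apply: eq_modC.
Qed.

Context (twinicI : forall A x y,
  sub_mod I (lmul_set x A) (~` A) -> sub_mod I (~` A) (lmul_set y A) ->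
  eq_mod I (lmul_set x A) (lmul_set y A)).

(** Let [x] flip [A] and [y] flip [B]. Modulo [I], [yB] equals the complement of [B], which lies in
    the complement of [A], which equals [xA], which lies in [xB]. The twinic property of [B]
    identifies the two ends [yB] and [xB], so the chain collapses. *)
Lemma twin_mod_sub_eq A B :
  twin_mod A -> twin_mod B -> A `<=` B -> eq_mod I A B.
Proof.
move=> [x [xA Ax]] [y [yB By]] AB; split; first exact: sub_mod_subset.
have xAB : sub_mod I (lmul_set x A) (lmul_set x B).
  exact/sub_mod_subset/lmul_setS.
have BA : sub_mod I (~` B) (~` A) by apply/sub_mod_subset/subsetC.
have [_ xByB] : eq_mod I (lmul_set y B) (lmul_set x B).
  apply: twinicI => //; apply: (sub_mod_trans BA); exact: sub_mod_trans xAB.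
have: sub_mod I (~` A) (~` B).
  by apply: sub_mod_trans Ax _; apply: sub_mod_trans xAB _;
     apply: sub_mod_trans xByB _.
by move/sub_modC; rewrite !setCK.
Qed.

End ModIdeal.

(** * Twin sets and minimal covering families *)

Section TwinFamilies.
Context {X : groupType}.
Implicit Types (x y k : X) (A B K : set X) (F G : set (set X)).

(** Modulo the ideal whose only member is the empty set, equality is exact, so facts on [Fix_minus]
    become instances of those on [Fix_minus_mod]. *)
Lemma set_ideal_set0 : set_ideal [set set0 : set X].
Proof.
split; first by exists set0.
- by move=> A B -> ->; rewrite /= setU0.
- by move=> A B AB B0; rewrite B0 in AB; apply/seteqP; split.
- by move=> T0; have : [set: X] 1 by []; rewrite T0.
Qed.

Lemma left_invariant_set0 : left_invariant [set set0 : set X].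
Proof. by move=> x A ->; rewrite /= lmul_set0. Qed.

Lemma eq_mod_set0 A B : eq_mod [set set0] A B <-> A = B.
Proof.
split=> [[AB BA]|->]; last exact: (eq_mod_refl set_ideal_set0).
by apply/seteqP; split; rewrite -setD_eq0.
Qed.

Lemma Fix_minus_mod_set0 A : Fix_minus_mod [set set0] A = Fix_minus A.
Proof. by apply/seteqP; split=> x /eq_mod_set0. Qed.

Lemma twin_modE0 A : twin_mod [set set0] A = twin_sets A.
Proof. by rewrite /twin_mod Fix_minus_mod_set0. Qed.

Lemma Fix_minus_two_cogroup A : twin_sets A -> two_cogroup (Fix_minus A).
Proof.
rewrite -twin_modE0 -Fix_minus_mod_set0.
exact: (Fix_minus_mod_two_cogroup set_ideal_set0 left_invariant_set0).
Qed.

Lemma Fix_minus_mul A k x :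
  Fix_minus A k -> Fix_minus A (k * x) <-> lmul_set x A = A.
Proof.
rewrite -Fix_minus_mod_set0.
move=> /(Fix_minus_mod_mul set_ideal_set0 left_invariant_set0) ->.
exact: eq_mod_set0.
Qed.

Lemma Fix_minus_lmul x A : Fix_minus (lmul_set x A) = conj_set x (Fix_minus A).
Proof.
by rewrite -!Fix_minus_mod_set0 (Fix_minus_mod_lmul left_invariant_set0).
Qed.

Lemma twin_set_neq A : twin_sets A -> A <> set0 /\ A <> setT.
Proof.
move=> [x xA]; have no : ~ ~` A = A.
  move=> CA; apply: (eq_mod_setC set_ideal_set0 (A := A)).
  by rewrite CA; apply/eq_mod_set0.
move: xA; rewrite /Fix_minus /= => xA.
by split=> A0; apply: no; rewrite -xA A0 ?lmul_set0 ?lmul_setT.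
Qed.

Lemma maximal_twin_lmul x A :
  maximal_twin_sets A -> maximal_twin_sets (lmul_set x A).
Proof.
move=> [[k Fk] mA]; split; last by rewrite Fix_minus_lmul; apply: conj_maximal.
exists (x * k * x^-1).
by rewrite Fix_minus_lmul /conj_set /= !mulgA mulVg mul1g mulgVK.
Qed.

(* With H = KK and G = H `|` K, choose a point c in each right coset of G and
   take the union of the cosets Hc; multiplying by an element of K exchanges
   Hc and Kc. *)
Lemma two_cogroup_sub_Fix_minus K :
  two_cogroup K -> exists A, K `<=` Fix_minus A.
Proof.
move=> /two_cogroupP[[k Kk] KV KM KN].
pose H : set X := [set a * b | a in K & b in K].
pose G := H `|` K.
have KKH a b : K a -> K b -> H (a * b).
  by move=> Ka Kb; exists a => //; exists b.
have HK x : H x -> ~ K x by move=> [a Ka [b Kb <-]]; apply: KN.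
have KHK a x : K a -> H x -> K (a * x).
  by move=> Ka [b Kb [c Kc <-]]; rewrite mulgA; apply: KM.
have HV x : H x -> H x^-1.
  by move=> [a Ka [b Kb <-]]; rewrite invgM; apply: KKH; apply: KV.
have GV x : G x -> G x^-1 by move=> [/HV|/KV]; [left | right].
have KG a x : K a -> G x -> G (a * x).
  by move=> Ka [/(KHK a _ Ka)|/(KKH a _ Ka)]; [right | left].
have GM x y : G x -> G y -> G (x * y).
  move=> [[a Ka [b Kb <-]]|Kx] Gy; last exact: KG.
  by rewrite -mulgA; apply: (KG _ _ Ka); apply: (KG _ _ Kb).
have G1 : G 1 by rewrite -(mulgV k); apply: GM; [right | apply: GV; right].
pose c x := xget 1 [set y | G (y * x^-1)].
have Gc x : G (x * (c x)^-1).
  rewrite -[x]invgK -invgM invgK; apply: GV.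
  apply: (xgetPex 1 (P := [set y | G (y * x^-1)])).
  by exists x; rewrite /= mulgV.
have cK a x : K a -> c (a * x) = c x.
  move=> Ka; rewrite /c; congr xget; apply/seteqP.
  split=> z /= Gz; last by rewrite invgM mulgA; apply: GM => //; apply: GV; right.
  by have := GM _ _ Gz (or_intror Ka); rewrite invgM mulgA mulgVK.
exists [set x | H (x * (c x)^-1)] => a Ka; rewrite /Fix_minus /=.
apply/seteqP; split=> x; rewrite lmul_setE /= (cK _ _ (KV _ Ka)) -mulgA.
  move=> Hax Hx; apply: (HK _ Hax); apply: KHK => //; exact: KV.
move=> nHx; case: (Gc x) => // Kx.
by apply: KKH => //; apply: KV.
Qed.

Lemma maximal_two_cogroup_Fix_minus K :
  maximal_two_cogroups K -> exists2 A, maximal_twin_sets A & Fix_minus A = K.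
Proof.
move=> mK; have [cK Kmax] := mK.
have [A KA] := two_cogroup_sub_Fix_minus cK.
have twA : twin_sets A by have /two_cogroupP[[x /KA Fx] _ _ _] := cK; exists x.
have FA : Fix_minus A = K by apply: Kmax => //; apply: Fix_minus_two_cogroup.
by exists A => //; split; rewrite ?FA.
Qed.

Lemma covering_maximal_twin : covering (@maximal_twin_sets X).
Proof.
split; first by move=> A [].
- by move=> x A; apply: maximal_twin_lmul.
- exact: maximal_two_cogroup_Fix_minus.
Qed.

(** Otherwise the orbit of [B] could be deleted from [F]: translates of [A] realize every 2-cogroup
    that translates of [B] do. *)
Lemma minimal_covering_orbit F A B : minimal_covering F -> F A -> F B ->
  Fix_minus A = Fix_minus B -> exists x, B = lmul_set x A.
Proof.
move=> [[Ftw Finv Fcov] Fmin] FA FB AB; apply: contrapT => nAB.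
pose G := [set C | F C /\ ~ exists x, C = lmul_set x B].
suff GF : G = F.
  rewrite -GF in FB; case: FB => _; apply.
  by exists 1; rewrite lmul_set1.
apply: Fmin => [C []//|]; split=> [C [/Ftw]//|x C [FC nC]|K mK].
  split; first exact: Finv.
  move=> [y xCy]; apply: nC; exists (x^-1 * y).
  by rewrite -lmul_setM -xCy lmul_setK.
have [C FC FK] := Fcov K mK.
have [[x Cx]|nC] := pselect (exists x, C = lmul_set x B); last by exists C.
exists (lmul_set x A); last by rewrite Fix_minus_lmul AB -Fix_minus_lmul -Cx.
split; first exact: Finv.
move=> [y xAy]; apply: nAB; exists (y^-1 * x).
by rewrite -lmul_setM xAy lmul_setK.
Qed.

(** Maximal twin sets are classed by the conjugacy class of their [Fix_minus]; [F] consists of the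
    orbits of one representative per class. *)
Lemma exists_minimal_covering :
  exists2 F, minimal_covering F & F `<=` @maximal_twin_sets X.
Proof.
pose conjugate A : set (set X) :=
  [set B | exists x, Fix_minus B = Fix_minus (lmul_set x A)].
have conj_refl A : conjugate A A by exists 1; rewrite lmul_set1.
have conj_sym A B : conjugate A B -> conjugate B A.
  move=> [x BA]; exists x^-1.
  by rewrite Fix_minus_lmul BA -Fix_minus_lmul lmul_setK.
have conj_trans A B C : conjugate A B -> conjugate B C -> conjugate A C.
  move=> [x BA] [y CB]; exists (y * x).
  by rewrite CB Fix_minus_lmul BA -Fix_minus_lmul lmul_setM.
pose rep A := xget set0 (conjugate A).
have conj_rep A : conjugate A (rep A) by apply: xgetPex; exists A.
have rep_eq A B : conjugate A B -> rep A = rep B.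
  move=> AB; rewrite /rep; congr xget; apply/seteqP; split=> C hC.
    by apply: conj_trans hC; apply: conj_sym.
  exact: conj_trans hC.
have rep_max A : maximal_twin_sets A -> maximal_twin_sets (rep A).
  move=> mA; have [x rA] := conj_rep A.
  have [tw mF] := maximal_twin_lmul x mA.
  by split; rewrite /twin_sets /= rA.
pose F := [set C | exists x A, maximal_twin_sets A /\ C = lmul_set x (rep A)].
have Fmax : F `<=` maximal_twin_sets.
  by move=> _ [x [A [mA ->]]]; apply/maximal_twin_lmul/rep_max.
exists F => //; split.
  split=> [A /Fmax[]//|x _ [y [A [mA ->]]]|K mK].
    by exists (x * y), A; rewrite lmul_setM.
  have [A mA <-] := maximal_two_cogroup_Fix_minus mK.
  have [x AR] := conj_sym _ _ (conj_rep A).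
  by exists (lmul_set x (rep A)) => //; exists x, A.
move=> G GF [Gtw Ginv Gcov]; apply/seteqP; split=> // _ [x [A [mA ->]]].
have [_ mK] := rep_max A mA.
have [C GC CA] := Gcov _ mK.
have [y [B [mB CB]]] := GF _ GC.
(* [C] in [G] realizes the 2-cogroup of [rep A] and is a translate of [rep B], so both
   representatives belong to one class. *)
suff AB : rep A = rep B.
  by rewrite AB -(lmul_setK y (rep B)) -CB lmul_setM; apply: Ginv.
apply: rep_eq; apply: (conj_trans _ _ _ (conj_rep A)); apply: conj_sym.
apply: (conj_trans _ _ _ (conj_rep B)).
by exists y; rewrite -CA CB.
Qed.

End TwinFamilies.

(** * Maximal linked systems as maps on subsets; the minimal ideal *)

Section Superextension.
Context {X : groupType}.
Implicit Types (x : X) (A B : set X) (L M N P Q : set (set X)).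

(** These maps are exactly the function representations of maximal linked systems, with composition
    matching [superext_op]. *)
Definition set_endo (f : set X -> set X) : Prop :=
  [/\ forall x A, f (lmul_set x A) = lmul_set x (f A),
      forall A B, A `<=` B -> f A `<=` f B
    & forall A, f (~` A) = ~` f A].

Lemma set_endo_comp f g : set_endo f -> set_endo g -> set_endo (f \o g).
Proof.
move=> [fM fS fC] [gM gS gC]; split=> [x A|A B AB|A] /=.
- by rewrite gM fM.
- exact/fS/gS.
- by rewrite gC fC.
Qed.

Lemma set_endo0 f : set_endo f -> f set0 = set0.
Proof.
move=> [_ fS fC]; apply/seteqP; split=> // x f0x.
have : f (~` set0) x by apply: (fS set0).
by rewrite fC.
Qed.

Lemma set_endoT f : set_endo f -> f setT = setT.
Proof. by move=> fE; have [_ _ fC] := fE; rewrite -setC0 fC set_endo0. Qed.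

Lemma superextensionP L : superextension L <->
  (forall A B, A `<=` B -> L A -> L B) /\ (forall A, L (~` A) <-> ~ L A).
Proof.
split=> [[Llink Lmax]|[LS LC]]; last first.
  have Llink : linked L.
    move=> A B LA LB; apply: contrapT => /nonemptyPn/disjoints_subset AB.
    by have /LC := LS _ _ AB LA.
  split=> // C Clink LsubC; apply/seteqP; split=> // A CA.
  apply: contrapT => /LC/LsubC/(Clink _ _ CA)[x []]; exact.
(* Adjoining [A] keeps the system linked; nonemptiness is what lets [A] meet itself. *)
have mem A : A !=set0 -> (forall B, L B -> A `&` B !=set0) -> L A.
  move=> A0 AL; rewrite -(Lmax (L `|` [set A])); [by right| |by move=> B; left].
  move=> B C [LB|->] [LC|->]; first exact: Llink.
  - by rewrite setIC; apply: AL.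
  - exact: AL.
  - by rewrite setIid.
have LS A B : A `<=` B -> L A -> L B.
  move=> AB LA; apply: mem => [|C LC].
    by have [x [Ax _]] := Llink _ _ LA LA; exists x; apply: AB.
  by have [x [Ax Cx]] := Llink _ _ LA LC; exists x; split => //; apply: AB.
split=> // A; split=> [LCA LA|nLA]; first by have [x []] := Llink _ _ LCA LA.
apply: contrapT => nLCA; apply: nLA; apply: (mem A).
  (* If [A] is empty, its complement is all of [X], which contains [1] and meets every member. *)
  apply: contrapT => A0; apply: nLCA; apply: (mem (~` A)) => [|B LB].
    by exists 1 => A1; apply: A0; exists 1.
  have [x [Bx _]] := Llink _ _ LB LB.
  by exists x; split=> // Ax; apply: A0; exists x.
move=> B LB; apply: contrapT => AB; apply: nLCA; apply: LS LB => x Bx Ax.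
by apply: AB; exists x.
Qed.

Lemma function_repr1 L A : function_repr L A 1 = L A.
Proof. by rewrite /function_repr /= invg1 lmul_set1. Qed.

Lemma function_repr_inj : injective (@function_repr X).
Proof. by move=> L M LM; apply/funext => A; rewrite -!function_repr1 LM. Qed.

Lemma function_repr_lmul L x A :
  function_repr L (lmul_set x A) = lmul_set x (function_repr L A).
Proof.
apply/funext => y.
by rewrite lmul_setE /function_repr /= lmul_setM invgM invgK.
Qed.

Lemma function_repr_op L M :
  function_repr (superext_op L M) = function_repr L \o function_repr M.
Proof.
apply/funext => A; apply/funext => x /=.
rewrite /function_repr /superext_op /= -/(function_repr M _).
by rewrite function_repr_lmul.
Qed.

Lemma superext_opA : associative (@superext_op X).
Proof. by move=> L M N; apply: function_repr_inj; rewrite !function_repr_op. Qed.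

Lemma function_repr_endo L : superextension L -> set_endo (function_repr L).
Proof.
move=> /superextensionP[LS LC]; split; first exact: function_repr_lmul.
  by move=> A B AB x; apply: LS; apply: lmul_setS.
move=> A; apply/seteqP; rewrite /function_repr.
by split=> x /=; rewrite lmul_setC => /LC.
Qed.

(** The system is read off from the values of [f] at the identity; equivariance recovers the other
    points. *)
Lemma function_repr_surj f :
  set_endo f -> exists2 L, superextension L & function_repr L = f.
Proof.
move=> [fM fS fC]; exists [set A | f A 1].
  apply/superextensionP; split=> [A B AB|A] /=; first exact: fS.
  by rewrite fC.
apply/funext => A; apply/funext => x.
by rewrite /function_repr /= fM lmul_setE invgK mulg1.
Qed.

Lemma superext_op_closed L M :
  superextension L -> superextension M -> superextension (superext_op L M).
Proof.
move=> /function_repr_endo LE /function_repr_endo ME.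
have [N N_ext NE] := function_repr_surj (set_endo_comp LE ME).
suff -> : superext_op L M = N by [].
by apply: function_repr_inj; rewrite function_repr_op NE.
Qed.

Definition principal_ideal M : set (set (set X)) :=
  [set N | exists P Q, [/\ superextension P, superextension Q
                         & N = superext_op P (superext_op M Q)]].

Lemma principal_two_sided_ideal M :
  superextension M -> two_sided_ideal (principal_ideal M).
Proof.
move=> M_ext; split; first by exists (superext_op M (superext_op M M)), M, M.
  by move=> _ [P [Q [? ? ->]]]; do 2 ?[apply: superext_op_closed => //].
move=> L _ L_ext [P [Q [P_ext Q_ext ->]]]; split.
  exists (superext_op L P), Q; split=> //; first exact: superext_op_closed.
  by rewrite superext_opA.
exists P, (superext_op Q L); split=> //; first exact: superext_op_closed.
by rewrite -!superext_opA.
Qed.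

(** The minimal ideal lies in every principal ideal. Conversely, no smallest ideal is presupposed:
    if [L] lies in every principal ideal, then any ideal contains some [M], hence [L], hence the
    principal ideal of [L], which is thus the smallest. *)
Lemma minimal_idealP L : superextension L ->
  minimal_ideal L <-> forall m, set_endo m ->
    exists p q, [/\ set_endo p, set_endo q & function_repr L = p \o m \o q].
Proof.
move=> L_ext.
split=> [[I [I_ideal I_min] IL] m /function_repr_surj[M M_ext <-]|Lm].
  have [P [Q [P_ext Q_ext ->]]] :=
    I_min _ (principal_two_sided_ideal M_ext) _ IL.
  exists (function_repr P), (function_repr Q).
  by rewrite !function_repr_op; split=> //; apply: function_repr_endo.
have Lprincipal M : superextension M -> principal_ideal M L.
  move=> /function_repr_endo/Lm[_ [_ [/function_repr_surj[P P_ext <-]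
    /function_repr_surj[Q Q_ext <-] LPMQ]]].
  exists P, Q; split=> //; apply: function_repr_inj.
  by rewrite !function_repr_op LPMQ.
exists (principal_ideal L); last exact: Lprincipal.
split; first exact: principal_two_sided_ideal.
move=> J [[M JM] J_ext J_op] _ [P [Q [P_ext Q_ext ->]]].
have JPMQ P' N Q' : superextension P' -> superextension Q' -> J N ->
    J (superext_op P' (superext_op N Q')).
  move=> P'_ext Q'_ext JN; have [_ JNQ] := J_op _ _ Q'_ext JN.
  by have [] := J_op _ _ P'_ext JNQ.
apply: (JPMQ P L Q) => //.
by have [P' [Q' [P'_ext Q'_ext ->]]] := Lprincipal _ (J_ext _ JM); apply: JPMQ.
Qed.

End Superextension.

(** * Action of these maps on twin sets and covering families *)

Section EndoTwins.
Context {X : groupType}.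
Implicit Types (x : X) (A B : set X) (F : set (set X)).

Lemma endo_Fix_minus f A : set_endo f -> Fix_minus A `<=` Fix_minus (f A).
Proof.
by move=> [fM _ fC] x; rewrite /Fix_minus /= -fM => ->; rewrite fC.
Qed.

Lemma endo_twin f A : set_endo f -> twin_sets A -> twin_sets (f A).
Proof. by move=> fE [x Fx]; exists x; apply: endo_Fix_minus. Qed.

(** [f] can only enlarge [Fix_minus], and maximality leaves no room. *)
Lemma endo_maximal_Fix_minus f A :
  set_endo f -> maximal_twin_sets A -> Fix_minus (f A) = Fix_minus A.
Proof.
move=> fE [twA [_ Kmax]]; apply: Kmax; last exact: endo_Fix_minus.
exact/Fix_minus_two_cogroup/endo_twin.
Qed.

Lemma endo_maximal_twin f A :
  set_endo f -> maximal_twin_sets A -> maximal_twin_sets (f A).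
Proof.
move=> fE mA; have [twA mK] := mA.
by split; [exact: endo_twin | rewrite endo_maximal_Fix_minus].
Qed.

Lemma endo_image_maximal f F : set_endo f ->
  F `<=` maximal_twin_sets -> f @` F `<=` maximal_twin_sets.
Proof. by move=> fE Fmax _ [A /Fmax mA <-]; apply: endo_maximal_twin. Qed.

Lemma endo_covering f F : set_endo f ->
  F `<=` maximal_twin_sets -> covering F -> covering (f @` F).
Proof.
move=> fE Fmax [Ftw Finv Fcov]; split.
- by move=> A /(endo_image_maximal fE Fmax)[].
- move=> x _ [A FA <-]; exists (lmul_set x A); first exact: Finv.
  by case: fE.
- move=> K /Fcov[A FA AK]; exists (f A); first by exists A.
  by rewrite endo_maximal_Fix_minus // ; apply: Fmax.
Qed.

(** A covering subfamily of the image pulls back to a covering subfamily of [F], since [f] preserves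
    [Fix_minus] there. *)
Lemma endo_minimal_covering f F : set_endo f ->
  F `<=` maximal_twin_sets -> minimal_covering F -> minimal_covering (f @` F).
Proof.
move=> fE Fmax [Fc Fmin]; split; first exact: endo_covering.
move=> G GfF [Gtw Ginv Gcov]; apply/seteqP; split=> // _ [A FA <-].
have [_ Finv _] := Fc.
suff : [set B | F B /\ G (f B)] = F by move=> FG; move: FA; rewrite -FG => -[].
apply: Fmin => [B []//|]; split=> [B [/Fmax[]]//|x B [FB GfB]|K mK].
  by split; [exact: Finv | have [-> _ _] := fE; apply: Ginv].
have [C GC CK] := Gcov _ mK.
have [B FB BC] := GfF _ GC.
exists B; first by rewrite /= BC.
by rewrite -CK -BC endo_maximal_Fix_minus //; apply: Fmax.
Qed.

(** Equal images force equal [Fix_minus], hence [B = xA] with [x] stabilizing [h A]. As [A] and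
    [h A] share their [Fix_minus], they share their stabilizer, so [x] fixes [A]. *)
Lemma minimal_covering_endo_inj h F : set_endo h ->
  F `<=` maximal_twin_sets -> minimal_covering F ->
  forall A B, F A -> F B -> h A = h B -> A = B.
Proof.
move=> hE Fmax Fmin A B FA FB hAB.
have AB : Fix_minus A = Fix_minus B.
  by rewrite -(endo_maximal_Fix_minus hE (Fmax _ FA)) hAB
    (endo_maximal_Fix_minus hE (Fmax _ FB)).
have [x Bx] := minimal_covering_orbit Fmin FA FB AB.
have [[k Fk] _] := Fmax _ FA.
have hFk := endo_Fix_minus hE Fk.
have xhA : lmul_set x (h A) = h A.
  by have [hM _ _] := hE; rewrite -hM -Bx.
rewrite Bx; apply/esym/(Fix_minus_mul x Fk).
rewrite -(endo_maximal_Fix_minus hE (Fmax _ FA)).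
exact/(Fix_minus_mul x hFk).
Qed.

(** Conditions (1) and (2) of the theorem, for an arbitrary map. *)
Definition minimal_range (f : set X -> set X) : Prop :=
  minimal_covering (f @` maximal_twin_sets) /\
  range f `<=` [set set0; [set: X]] `|` f @` maximal_twin_sets.

Lemma minimal_range_comp p m q : set_endo p -> set_endo m -> set_endo q ->
  minimal_range m -> minimal_range (p \o m \o q).
Proof.
move=> pE mE qE [mmin mrange].
have mmax := endo_image_maximal mE (@subset_refl _ maximal_twin_sets).
have qmax := endo_image_maximal qE (@subset_refl _ maximal_twin_sets).
(* The left side is a covering subfamily of the right one, so minimality removes [q]. *)
have mq : (m \o q) @` maximal_twin_sets = m @` maximal_twin_sets.
  have [_ mmin'] := mmin; apply: mmin'.
    by move=> _ [A mA <-]; exists (q A) => //; apply: endo_maximal_twin.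
  exact: (endo_covering (set_endo_comp mE qE) _ covering_maximal_twin).
have -> : minimal_range (p \o m \o q) =
    (minimal_covering (p @` (m @` maximal_twin_sets)) /\
     range (p \o m \o q) `<=` [set set0; [set: X]]
       `|` p @` (m @` maximal_twin_sets)).
  by rewrite -mq image_comp.
split; first exact: endo_minimal_covering.
move=> _ [A _ <-] /=.
have [[->|->]|mA] : ([set set0; setT] `|` m @` maximal_twin_sets) (m (q A)).
- by apply: mrange; exists (q A).
- by left; left; apply: set_endo0.
- by left; right; apply: set_endoT.
- by right; exists (m (q A)).
Qed.

End EndoTwins.

(** * Consequences of the twinic property *)

Section TwinicGroup.
Context {X : groupType} (I : set (set X)).
Context (idealI : set_ideal I) (invI : left_invariant I).
Context (twinicI : forall (A : set X) (x y : X),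
  sub_mod I (lmul_set x A) (~` A) -> sub_mod I (~` A) (lmul_set y A) ->
  eq_mod I (lmul_set x A) (lmul_set y A)).
Implicit Types (x y : X) (A B : set X) (F W : set (set X)).

(** For maximal twin sets [Fix_minus] is already determined modulo [I]. So [B = xA], and [x], fixing
    [A] modulo [I], fixes it exactly. *)
Lemma minimal_covering_eq_mod F A B :
  F `<=` maximal_twin_sets -> minimal_covering F ->
  F A -> F B -> eq_mod I A B -> A = B.
Proof.
move=> Fmax Fmin FA FB AB.
have [mA mB] := (Fmax _ FA, Fmax _ FB).
have FixAB : Fix_minus A = Fix_minus B.
  rewrite -!(maximal_Fix_minus_mod idealI invI) //.
  by apply/seteqP; split; apply: (Fix_minus_mod_eq idealI invI) => //;
    apply: eq_mod_sym.
have [x Bx] := minimal_covering_orbit Fmin FA FB FixAB.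
have [[k Fk] _] := mA.
rewrite Bx; apply/esym/(Fix_minus_mul x Fk).
rewrite -(maximal_Fix_minus_mod idealI invI) // in Fk *.
apply/(Fix_minus_mod_mul idealI invI x Fk).
by rewrite -Bx; apply: eq_mod_sym.
Qed.

Lemma minimal_covering_antichain F A B :
  F `<=` maximal_twin_sets -> minimal_covering F ->
  F A -> F B -> A `<=` B -> A = B.
Proof.
move=> Fmax Fmin FA FB AB; apply: (minimal_covering_eq_mod Fmax Fmin) => //.
have twF C : F C -> twin_mod I C.
  by move=> /Fmax[[x Fx] _]; exists x; apply: Fix_minus_sub_mod.
by apply: (twin_mod_sub_eq idealI twinicI) => //; apply: twF.
Qed.

Lemma minimal_range_factor (f m : set X -> set X) : set_endo f -> set_endo m ->
  minimal_range f -> exists2 p, set_endo p & f = p \o m \o f.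
Proof.
move=> fE mE [Fmin frange]; set F := f @` maximal_twin_sets in Fmin frange.
have Fmax : F `<=` maximal_twin_sets by apply: endo_image_maximal.
have hE := set_endo_comp fE mE; set h := f \o m in hE.
have [[Ftw Finv _] Fmin'] := Fmin.
have hF : h @` F = F.
  apply: Fmin'; last by apply: endo_covering => //; case: Fmin.
  by move=> _ [A FA <-]; exists (m A) => //; apply/endo_maximal_twin/Fmax.
have h_inj := minimal_covering_endo_inj hE Fmax Fmin.
(* The inverse of the permutation of [F] induced by [h]; the default value is never reached on
   [F]. *)
pose g B := xget set0 [set A | F A /\ h A = B].
have gP B : F B -> F (g B) /\ h (g B) = B.
  rewrite -{1}hF => -[A FA hA].
  by apply: (xgetPex set0 (P := [set A | F A /\ h A = B])); exists A.
have FC A : F A -> F (~` A).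
  by move=> FA; have [x <-] := Ftw _ FA; apply: Finv.
have nF0 : ~ F set0 by move=> /Ftw/twin_set_neq[].
have nFT : ~ F setT by move=> /Ftw/twin_set_neq[].
have fcases A : [\/ f A = set0, f A = setT | F (f A)].
  by have [[]|] := frange (f A) (ex_intro2 _ _ A Logic.I erefl);
    [constructor 1 | constructor 2 | constructor 3].
have [[hM _ hC] [fM fS fC]] := (hE, fE).
(* [p] is [f] followed by the inverse of [h] on [F] and by the identity on the empty set and [X]. *)
pose p A := if pselect (F (f A)) then g (f A) else f A.
have pF A : F (f A) -> p A = g (f A) by rewrite /p; case: pselect.
have pN A : ~ F (f A) -> p A = f A by rewrite /p; case: pselect.
have p0 A : f A = set0 -> p A = set0 by move=> fA; rewrite pN fA.
have pT A : f A = setT -> p A = setT by move=> fA; rewrite pN fA.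
exists p.
  split=> [x A|A B AB|A].
  - case: (fcases A) => [fA|fA|FfA].
    + by rewrite !p0 ?fM ?fA ?lmul_set0.
    + by rewrite !pT ?fM ?fA ?lmul_setT.
    + have FxA : F (f (lmul_set x A)) by rewrite fM; apply: Finv.
      have [[Fg hg] [Fgx hgx]] := (gP _ FfA, gP _ FxA).
      rewrite !pF //; apply: h_inj => //; first exact: Finv.
      by rewrite hM hg hgx fM.
  - case: (fcases A) => [/p0 -> //|fA|FfA].
      rewrite [p B]pT //; apply/seteqP; split=> // x _; apply: (fS _ _ AB).
      by rewrite fA.
    case: (fcases B) => [fB|/pT -> //|FfB].
      case: nF0; suff <- : f A = set0 by [].
      by apply/seteqP; split=> //; rewrite -fB; apply: fS.
    (* Monotonicity inside [F] is free: nested members of an antichain coincide. *)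
    rewrite !pF //.
    by rewrite (minimal_covering_antichain Fmax Fmin FfA FfB (fS _ _ AB)).
  - case: (fcases A) => [fA|fA|FfA].
    + by rewrite [p A]p0 // pT ?fC ?fA ?setC0.
    + by rewrite [p A]pT // p0 ?fC ?fA ?setCT.
    + have FCA : F (f (~` A)) by rewrite fC; apply: FC.
      have [[Fg hg] [Fgx hgx]] := (gP _ FfA, gP _ FCA).
      rewrite !pF //; apply: h_inj => //; first exact: FC.
      by rewrite hC hg hgx fC.
apply/funext => A /=; case: (fcases A) => [->|->|FfA].
- by rewrite (set_endo0 mE) p0 // set_endo0.
- by rewrite (set_endoT mE) pT // set_endoT.
- have Fh : F (h (f A)) by rewrite -hF; exists (f A).
  rewrite pF //; have [Fg hg] := gP _ Fh.
  by apply: h_inj.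
Qed.

(* W is a maximal left-invariant linked family of sets that are not small, where
   A is small if some translate of A is contained in ~` A modulo I. *)
Lemma exists_invariant_system : exists W,
  [/\ left_invariant W, forall A B, A `<=` B -> W A -> W B,
      forall A, W A -> ~ W (~` A)
    & forall A, twin_mod I A <-> ~ W A /\ ~ W (~` A)].
Proof.
pose small A := exists x, sub_mod I (lmul_set x A) (~` A).
have smallS A B : A `<=` B -> small B -> small A.
  move=> AB [x xB]; exists x.
  apply: (sub_mod_trans idealI (sub_mod_subset idealI (lmul_setS (x := x) AB))).
  by apply: (sub_mod_trans idealI xB); apply/(sub_mod_subset idealI)/subsetC.
have small_lmul x A : small (lmul_set x A) -> small A.
  move=> [y yA]; exists (x^-1 * y * x).
  move/(sub_mod_lmul invI x^-1): yA.
  by rewrite -lmul_setC lmul_setK !lmul_setM.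
have smallP A x : A `&` lmul_set x A = set0 -> small A.
  move=> A0; exists x; apply: (sub_mod_subset idealI) => y xAy Ay.
  by have : (A `&` lmul_set x A) y by []; rewrite A0.
have nsmallI A x y : ~ small A -> lmul_set x A `&` lmul_set y A !=set0.
  move=> nsA; apply: contrapT => xyA; apply: nsA; apply: (smallP _ (x^-1 * y)).
  apply/seteqP; split=> // z; rewrite -lmul_setM -{1}(lmul_setK x A) -lmul_setI.
  by rewrite lmul_setE => xyAz; apply: xyA; eexists; exact: xyAz.
pose P := [set W |
  [/\ left_invariant W, (forall A, W A -> ~ small A) & linked W]].
have [C CP Ctot|W [[Winv Wns Wlink] Wmax]] := @Zorn_bigcup _ P.
  split.
  - move=> x A [W CW WA]; exists W => //.
    by have [Winv _ _] := CP _ CW; apply: Winv.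
  - by move=> A [W CW WA]; have [_ + _] := CP _ CW; apply.
  - move=> A B [W CW WA] [V CV VB]; case: (Ctot _ _ CW CV) => [WV|VW].
      by have [_ _] := CP _ CV; apply => //; apply: WV.
    by have [_ _] := CP _ CW; apply => //; apply: VW.
(* By maximality all translates of [A] may be adjoined; they meet one another because [A] is not
   small. *)
have Wmem A : ~ small A ->
    (forall B x, W B -> B `&` lmul_set x A !=set0) -> W A.
  move=> nsA WA; apply: contrapT => nWA.
  apply: (Wmax (W `|` [set B | exists x, B = lmul_set x A])).
    split=> [B WB|WW]; first by left.
    by apply: nWA; apply: WW; right; exists 1; rewrite lmul_set1.
  split.
  - move=> x B [WB|[y ->]]; first by left; apply: Winv.
    by right; exists (x * y); rewrite lmul_setM.
  - by move=> B [/Wns//|[x ->]] /small_lmul.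
  - move=> B D [WB|[x ->]] [WD|[y ->]].
    + exact: Wlink.
    + exact: WA.
    + by rewrite setIC; apply: WA.
    + exact: nsmallI.
have Wdich A : ~ small A -> ~ W A -> W (~` A).
  move=> nsA nWA.
  (* Some member misses a translate of [A]; translating it back puts a member inside the complement
     of [A]. *)
  have [B WB BA] : exists2 B, W B & B `<=` ~` A.
    apply: contrapT => nB; apply: nWA; apply: Wmem => // B x WB.
    apply: contrapT => BxA; apply: nB; exists (lmul_set x^-1 B).
      exact: Winv.
    move=> y; rewrite lmul_setE invgK => Bxy Ay; apply: BxA.
    by exists (x * y); split=> //; rewrite lmul_setE mulKg.
  apply: Wmem => [/(smallS _ _ BA)|D x WD]; first exact: Wns.
  have [y [Dy xBy]] := Wlink _ _ WD (Winv x _ WB).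
  by exists y; split=> //; apply: (lmul_setS BA).
have WN A : W A -> ~ W (~` A).
  by move=> WA WCA; have [x []] := Wlink _ _ WA WCA.
exists W; split=> // [A B AB WA|A].
  apply: contrapT => nWB.
  have nsB : ~ small B by move=> /(smallS _ _ AB); apply: Wns.
  have WCB := Wdich _ nsB nWB.
  by have [x [Ax nBx]] := Wlink _ _ WA WCB; apply: nBx; apply: AB.
have tw_small B : twin_mod I B -> small B by move=> [x [xB _]]; exists x.
split=> [twA|[nWA nWCA]].
  split=> [/Wns|/Wns]; apply; first exact: tw_small.
  exact/tw_small/twin_modC.
(* As neither set is in [W], both are small, which gives the two inclusions the twinic property asks
   for. *)
have [x xA] : small A by apply: contrapT => /Wdich /(_ nWA).
have [y yA] : small (~` A).
  by apply: contrapT => /Wdich /(_ nWCA); rewrite setCK.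
have Ay : sub_mod I (~` A) (lmul_set y A).
  by move: yA => /sub_modC; rewrite setCK -lmul_setC setCK.
have [_ yx] := twinicI xA Ay.
exists x; split=> //; exact: (sub_mod_trans idealI Ay yx).
Qed.

(** A value [t R] in [F] is chosen for one representative [R] of each orbit modulo [I], with
    [Fix_minus] containing that of [R] modulo [I], and is extended by translation. The translating
    element is immaterial, since whatever fixes a twin [R] modulo [I] fixes [t R] exactly. *)
Lemma exists_twin_retraction F : minimal_covering F ->
  exists r : set X -> set X, [/\ forall A, twin_mod I A -> F (r A),
      forall A, twin_mod I A -> Fix_minus_mod I A `<=` Fix_minus (r A)
    & forall x A B, twin_mod I B -> eq_mod I A (lmul_set x B) ->
        r A = lmul_set x (r B)].
Proof.
move=> [[Ftw Finv Fcov] _].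
have eqT := eq_mod_trans idealI; have eqS := @eq_mod_sym X I.
have /choice[t tP] A : exists B, twin_mod I A ->
    F B /\ Fix_minus_mod I A `<=` Fix_minus B.
  have [twA|] := pselect (twin_mod I A); last by exists set0.
  have [M mM AM] :=
    two_cogroup_sub_maximal (Fix_minus_mod_two_cogroup idealI invI twA).
  by have [B FB BM] := Fcov _ mM; exists B; rewrite BM.
pose orbit A := [set B | exists x, eq_mod I B (lmul_set x A)].
have orbit_sym A B : orbit A B -> orbit B A.
  move=> [x /(eq_mod_lmul invI x^-1)]; rewrite lmul_setK => BA.
  by exists x^-1; apply: eqS.
have orbit_trans A B C : orbit A B -> orbit B C -> orbit A C.
  move=> [x BA] [y CB]; exists (y * x); rewrite -lmul_setM.
  by apply: (eqT _ _ _ CB); apply: eq_mod_lmul.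
have orbit_refl A : orbit A A.
  by exists 1; rewrite lmul_set1; apply: eq_mod_refl.
pose rep A := xget set0 (orbit A).
have orbit_rep A : orbit A (rep A) by apply: xgetPex; exists A.
have rep_eq A B : orbit A B -> rep A = rep B.
  move=> AB; rewrite /rep; congr xget; apply/seteqP; split=> C hC.
    by apply: orbit_trans hC; apply: orbit_sym.
  exact: orbit_trans hC.
have /choice[g gP] A : exists x, eq_mod I A (lmul_set x (rep A)).
  exact: orbit_sym.
have tw_rep A : twin_mod I A -> twin_mod I (rep A).
  have [x xA] := orbit_rep A; move=> /(twin_mod_lmul invI x)[k Fk].
  by exists k; apply: (Fix_minus_mod_eq idealI invI (eqS _ _ xA)).
exists (fun A => lmul_set (g A) (t (rep A))).
split=> [A /tw_rep/tP[? _]|A /tw_rep/tP[_ tFix] y|x A B twB AxB].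
- exact: Finv.
- move=> /(Fix_minus_mod_eq idealI invI (gP A)).
  by rewrite Fix_minus_mod_lmul // Fix_minus_lmul => /tFix.
have AB : rep A = rep B by apply: rep_eq; apply: orbit_sym; exists x.
have [gA gB] := (gP A, gP B); rewrite AB in gA *.
have [_ tFix] := tP _ (tw_rep _ twB).
have [k Fk] := tw_rep _ twB.
set y := g A; set z := g B; set R := rep B.
(* Both [yR] and [xzR] equal [A] modulo [I], so this element stabilizes [R] modulo [I]. *)
suff yzR : lmul_set (y^-1 * (x * z)) (t R) = t R.
  by rewrite -{1}yzR !lmul_setM mulVKg.
apply/(Fix_minus_mul _ (tFix _ Fk))/tFix/(Fix_minus_mod_mul idealI invI _ Fk).
rewrite -lmul_setM; apply: (eq_mod_lmulV invI (x := y)); rewrite lmul_setVK.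
apply: (eqT _ _ _ _ gA); apply: eqS; apply: (eqT _ _ _ AxB).
by rewrite -lmul_setM; apply: eq_mod_lmul.
Qed.

Lemma exists_minimal_range :
  exists2 f : set X -> set X, set_endo f & minimal_range f.
Proof.
have [F Fmin Fmax] := @exists_minimal_covering X.
have [W [Winv WS WN Wtw]] := exists_invariant_system.
have [r [rF rFix rM]] := exists_twin_retraction Fmin.
have [[_ Finv _] Fmin'] := Fmin.
pose f A := if pselect (W A) then setT
  else if pselect (W (~` A)) then set0 else r A.
have fT A : W A -> f A = setT by rewrite /f; case: pselect.
have f0 A : W (~` A) -> f A = set0.
  move=> WCA; rewrite /f; case: pselect => [/WN//|nWA] /=.
  by case: pselect.
have fr A : twin_mod I A -> f A = r A.
  by move=> /Wtw[nWA nWCA]; rewrite /f; do 2 case: pselect => //.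
have cases A : [\/ W A, W (~` A) | twin_mod I A].
  have [?|nWA] := pselect (W A); first by constructor 1.
  have [?|nWCA] := pselect (W (~` A)); first by constructor 2.
  by constructor 3; apply/Wtw.
have rC A : twin_mod I A -> r (~` A) = ~` r A.
  move=> twA; have [k Fk] := twA.
  have <- : lmul_set k (r A) = ~` r A by apply: rFix Fk.
  by apply: rM => //; apply: eq_mod_sym.
have fE : set_endo f.
  split=> [x A|A B AB|A].
  - case: (cases A) => [WA|WCA|twA].
    + by rewrite !fT ?lmul_setT //; apply: Winv.
    + by rewrite !f0 ?lmul_set0 // -lmul_setC; apply: Winv.
    + rewrite !fr //; last exact: twin_mod_lmul.
      by apply: rM => //; apply: eq_mod_refl.
  - case: (cases A) => [WA|/f0 -> //|twA].
      by rewrite [f B]fT //; apply: WS WA.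
    case: (cases B) => [/fT -> //|WCB|twB].
      by have [_ []] := (Wtw A).1 twA; apply: WS WCB; apply: subsetC.
    (* Nested twin sets agree modulo [I], so [r] takes the same value on both. *)
    rewrite !fr // (rM 1 A B) ?lmul_set1 //.
    exact: (twin_mod_sub_eq idealI twinicI).
  - case: (cases A) => [WA|WCA|twA].
    + by rewrite [f A]fT // f0 ?setCT // setCK.
    + by rewrite [f A]f0 // fT ?setC0.
    + by rewrite !fr ?rC //; apply: twin_modC.
have twF A : maximal_twin_sets A -> twin_mod I A.
  by move=> [[x Fx] _]; exists x; apply: Fix_minus_sub_mod.
have fF : f @` maximal_twin_sets = F.
  apply: Fmin' => [_ [A /twF twA <-]|]; first by rewrite fr //; apply: rF.
  exact: endo_covering covering_maximal_twin.
exists f => //; split; first by rewrite fF.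
move=> _ [A _ <-]; rewrite fF.
case: (cases A) => [/fT ->|/f0 ->|twA]; first by left; right.
- by left; left.
- by right; rewrite fr //; apply: rF.
Qed.

End TwinicGroup.

Theorem corollary17p2 (X : groupType) (hX : twinic X)
    (L : set (set X)) (hL : superextension L) :
  minimal_ideal L <->
    minimal_covering (function_repr L @` maximal_twin_sets) /\
    range (function_repr L) `<=`
      [set set0; [set: X]] `|` function_repr L @` maximal_twin_sets.
Proof.
have [I [idealI invI twinicI]] := hX.
split=> [/(minimal_idealP hL) Lm|Lmin].
  have [m mE mmin] := exists_minimal_range idealI invI twinicI.
  have [p [q [pE qE ->]]] := Lm m mE.
  exact: minimal_range_comp.
apply/(minimal_idealP hL) => m mE.
have LE := function_repr_endo hL.
have [p pE Lp] := minimal_range_factor idealI invI twinicI LE mE Lmin.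
by exists p, (function_repr L).
Qed.
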